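(* Let $n\ge2$. There is no $|2|$-grading $\mathfrak g_{-2}\oplus\cdots\oplus\mathfrak g_2$ of $\mathfrak g=\mathfrak{so}(2n+1,\mathbb C)$ with $\dim\mathfrak g_{-2}>1$ such that the dimensions of its negative part match the dimensions of a pseudo $H$-type Lie algebra; that is, for no such grading does there exist a pseudo $H$-type Lie algebra $\mathfrak n=\mathfrak n_{-2}\oplus\mathfrak n_{-1}$ with $\dim_{\mathbb R}\mathfrak n_{-2}=\dim_{\mathbb C}\mathfrak g_{-2}$ and $\dim_{\mathbb R}\mathfrak n_{-1}=\dim_{\mathbb C}\mathfrak g_{-1}$.
   Context: $|2|$-gradings: let $\mathfrak g$ be a complex simple Lie algebra with Cartan subalgebra $\mathfrak h$, simple roots $\alpha_1,\dots,\alpha_r$ and root spaces $\mathfrak g_\alpha$. For a set $\Sigma$ of simple roots and a root $\alpha=\sum_i a_i\alpha_i$, put $\mathrm{ht}_\Sigma(\alpha)=\sum_{i:\alpha_i\in\Sigma}a_i$. Set $\mathfrak g_k=\bigoplus_{\mathrm{ht}_\Sigma(\alpha)=k}\mathfrak g_\alpha$ for $k\ne0$ and $\mathfrak g_0=\mathfrak h\oplus\bigoplus_{\mathrm{ht}_\Sigma(\alpha)=0}\mathfrak g_\alpha$. If the highest root has $\Sigma$-height $2$ this is a $|2|$-grading, and all $|2|$-gradings are understood (up to isomorphism) to arise in this way. For $\mathfrak{so}(2n+1,\mathbb C)$ these are given by $\Sigma=\{\alpha_i\}$, $i=2,\dots,n$ (Bourbaki numbering). A pseudo $H$-type Lie algebra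 is a real graded 2-step nilpotent Lie algebra $\mathfrak n=\mathfrak n_{-2}\oplus\mathfrak n_{-1}$ (with $[\mathfrak n_{-1},\mathfrak n_{-1}]\subset\mathfrak n_{-2}$ and $\mathfrak n_{-2}$ central) endowed with a non-degenerate symmetric bilinear form $\langle\cdot,\cdot\rangle=\langle\cdot,\cdot\rangle_{\mathfrak n_{-2}}+\langle\cdot,\cdot\rangle_{\mathfrak n_{-1}}$ with $\langle\cdot,\cdot\rangle_{\mathfrak n_{-2}}$ non-degenerate, such that the maps $J_z\in\mathrm{End}(\mathfrak n_{-1})$, $z\in\mathfrak n_{-2}$, defined by $\langle J_zx,y\rangle_{\mathfrak n_{-1}}=\langle[x,y],z\rangle_{\mathfrak n_{-2}}$ for all $x,y\in\mathfrak n_{-1}$ satisfy $J_z^2=-\langle z,z\rangle_{\mathfrak n_{-2}}\mathrm{Id}_{\mathfrak n_{-1}}$. *)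

(* Defs.v *)
(* [R : realType] plays the role of the real numbers and [R[i]]
   that of the complex numbers.  All Lie algebras are finite dimensional. *)
From HB Require Import structures.
From mathcomp Require Import all_boot all_order all_algebra.
From mathcomp Require Import ring complex reals.

Set Implicit Arguments.
Unset Strict Implicit.
Unset Printing Implicit Defensive.

Import Order.TTheory GRing.Theory Num.Theory.
Local Open Scope ring_scope.

HB.mixin Record Vector_isLie (K : fieldType) L of Vector K L := {
  lie : L -> L -> L;
  lie_linearl : forall y, linear (lie^~ y);
  lie_linearr : forall x, linear (lie x);
  liexx : forall x, lie x x = 0;
  lie_jacobi : forall x y z,
    lie x (lie y z) + lie y (lie z x) + lie z (lie x y) = 0
}.

#[short(type="lieAlgType")]
HB.structure Definition LieAlgebra (K : fieldType) :=
  {L of Vector_isLie K L & Vector K L}.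

Notation "[[ x , y ]]" := (lie x y)
  (at level 0, x at level 99, y at level 99, format "[[ x ,  y ]]") : ring_scope.

HB.instance Definition _ (K : fieldType) (L : lieAlgType K) (x : L) :=
  GRing.isLinear.Build K L L *:%R (lie x) (lie_linearr x).

Definition ad (K : fieldType) (L : lieAlgType K) (x : L) : 'End(L) :=
  linfun (lie x).

Section Cartan.
Variables (K : fieldType) (L : lieAlgType K).

Definition abelian_subspace (h : {vspace L}) : Prop :=
  {in h &, forall x y, [[x, y]] = 0}.

Definition diagonalizable_end (V : vectType K) (f : 'End(V)) : Prop :=
  exists2 e : (\dim {:V}).-tuple V,
    basis_of fullv e & forall i, exists c : K, f (tnth e i) = c *: tnth e i.

(* The usual definition for semisimple complex Lie algebras: a maximal abelian
   subalgebra all of whose elements are ad-diagonalizable. *)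
Definition cartan_subalgebra (h : {vspace L}) : Prop :=
  [/\ abelian_subspace h,
      forall k : {vspace L}, abelian_subspace k -> (h <= k)%VS -> k = h
    & {in h, forall x, diagonalizable_end (ad x)}].

Definition dual (h : {vspace L}) := 'Hom(subvs_of h, K^o).

(* By linearity it suffices to impose [H, x] = a(H) x on a basis of h; see
   [mem_root_space]. *)
Definition root_space (h : {vspace L}) (a : dual h) : {vspace L} :=
  (\bigcap_(i < \dim {:subvs_of h})
     lker (ad (vsval (vbasis {:subvs_of h})`_i)
           - (a (vbasis {:subvs_of h})`_i : K) *: \1%VF))%VS.

Lemma mem_root_space (h : {vspace L}) (a : dual h) (x : L) :
  x \in root_space a <->
  forall H : subvs_of h, [[vsval H, x]] = (a H : K) *: x.
Proof.
rewrite memvE; split=> [/subv_bigcapP xP H|xP]; last first.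
  apply/subv_bigcapP => i _; rewrite -memvE memv_ker.
  by rewrite add_lfunE opp_lfunE scale_lfunE id_lfunE lfunE /= xP subrr.
have {}xP i : [[vsval (vbasis {:subvs_of h})`_i, x]]
              = (a (vbasis {:subvs_of h})`_i : K) *: x.
  have [ilt|ige] := ltnP i (\dim {:subvs_of h}).
    have := xP (Ordinal ilt) isT; rewrite -memvE memv_ker.
    rewrite add_lfunE opp_lfunE scale_lfunE id_lfunE lfunE /= subr_eq0.
    by move/eqP.
  rewrite nth_default ?size_tuple// !linear0 scale0r.
  by have /= := lie_linearl x (-1) 0 0; rewrite !scaleN1r !addNr.
pose f : {linear L -> L} := HB.pack (fun y : L => [[y, x]])
  (GRing.isLinear.Build K L L *:%R (fun y : L => [[y, x]]) (lie_linearl x)).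
rewrite (coord_vbasis (memvf H)).
rewrite -[LHS]/(f (vsval _)) !linear_sum scaler_suml.
by apply: eq_bigr => i _; rewrite !linearZ /= xP scalerA.
Qed.

End Cartan.

(* A Cartan subalgebra, the finite list of its roots, and a system of simple
   roots. *)
Record rootDatum (K : numFieldType) (L : lieAlgType K) := RootDatum {
  cartan : {vspace L};
  cartanP : cartan_subalgebra cartan;
  roots : seq (dual cartan);
  roots_uniq : uniq roots;
  rootsP : roots =i [pred a | (a != 0) && (root_space a != 0%VS)];
  rank : nat;
  simple : rank.-tuple (dual cartan);
  simple_basis : basis_of fullv simple;
  simple_roots : {subset simple <= roots};
  roots_signed : {in roots, forall a, exists c : 'I_rank -> nat,
    a = \sum_i tnth simple i *+ c i \/ a = - \sum_i tnth simple i *+ c i}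
}.

Section Grading.
Variables (K : numFieldType) (L : lieAlgType K) (D : rootDatum L).
Variable Sigma : {set 'I_(rank D)}.

Definition highest_root (t : dual (cartan D)) : Prop :=
  t \in roots D /\
  {in roots D, forall a, exists c : 'I_(rank D) -> nat,
     t - a = \sum_i tnth (simple D) i *+ c i}.

(* [Sigma] is a set of indices of simple roots; the height of a root is an
   integer, here seen in [K]. *)
Definition ht (a : dual (cartan D)) : K :=
  \sum_(i in Sigma) coord (simple D) i a.

Definition grading (k : int) : {vspace L} :=
  (\sum_(a <- roots D | ht a == k%:~R) root_space a
   + (if (k == 0)%R then cartan D else 0))%VS.

Definition is_abs2_grading : Prop :=
  exists2 t, highest_root t & ht t = 2.

End Grading.

Section SpecialOrthogonal.
Variables (K : fieldType) (N : nat).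

Definition so_space : {vspace 'M[K]_N} :=
  lker (linfun (fun A : 'M[K]_N => A + A^T)).

Definition so := subvs_of so_space.
HB.instance Definition _ := Vector.on so.

Fact so_sym_linear : linear (fun A : 'M[K]_N => A + A^T).
Proof. by move=> c A B; rewrite linearP /= scalerDr addrACA. Qed.

Lemma so_spaceP (A : 'M[K]_N) : reflect (A^T = - A) (A \in so_space).
Proof.
pose f : {linear 'M[K]_N -> 'M[K]_N} := HB.pack (fun A : 'M[K]_N => A + A^T)
  (GRing.isLinear.Build K _ _ *:%R (fun A : 'M[K]_N => A + A^T) so_sym_linear).
rewrite memv_ker -[linfun _]/(linfun f) lfunE /= addrC addr_eq0.
exact: eqP.
Qed.

Definition commutator (A B : 'M[K]_N) := A *m B - B *m A.

Fact commutator_linearl (C : 'M[K]_N) : linear (commutator^~ C).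
Proof.
move=> c A B; rewrite /commutator mulmxDl mulmxDr -scalemxAl -scalemxAr.
by rewrite scalerBr opprD addrACA.
Qed.

Fact commutator_linearr (C : 'M[K]_N) : linear (commutator C).
Proof.
move=> c A B; rewrite /commutator mulmxDl mulmxDr -scalemxAl -scalemxAr.
by rewrite scalerBr opprD addrACA.
Qed.

Fact commutator_jacobi (A B C : 'M[K]_N) :
  commutator A (commutator B C) + commutator B (commutator C A)
    + commutator C (commutator A B) = 0.
Proof.
rewrite /commutator !mulmxBl !mulmxBr !mulmxA !opprB.
move: (A *m B *m C) (A *m C *m B) (B *m A *m C) => a b c.
move: (B *m C *m A) (C *m A *m B) (C *m B *m A) => d e f.
apply/matrixP => i j; rewrite !mxE; ring.
Qed.

Fact commutator_so (x y : so) : commutator (vsval x) (vsval y) \in so_space.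
Proof.
apply/so_spaceP; rewrite /commutator linearB /= !trmx_mul.
have /so_spaceP -> := subvsP x; have /so_spaceP -> := subvsP y.
by rewrite !mulNmx !mulmxN !opprK opprB.
Qed.

Definition so_lie (x y : so) : so := Subvs (commutator_so x y).

Fact so_lie_linearl y : linear (so_lie^~ y).
Proof.
move=> c u v; apply: val_inj => /=.
by apply: commutator_linearl.
Qed.

Fact so_lie_linearr x : linear (so_lie x).
Proof.
move=> c u v; apply: val_inj => /=.
by apply: commutator_linearr.
Qed.

Fact so_liexx x : so_lie x x = 0.
Proof. by apply: val_inj; rewrite /= /commutator subrr. Qed.

Fact so_lie_jacobi x y z :
  so_lie x (so_lie y z) + so_lie y (so_lie z x) + so_lie z (so_lie x y) = 0.
Proof. by apply: val_inj => /=; apply: commutator_jacobi. Qed.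

HB.instance Definition _ := Vector_isLie.Build K so
  so_lie_linearl so_lie_linearr so_liexx so_lie_jacobi.

End SpecialOrthogonal.

(* [part2] and [part1] are n_{-2} and n_{-1}.  That n is nilpotent of step
   exactly 2 follows from [pseudoH_lie11], [pseudoH_central] and
   [pseudoH_nonabelian].  [Jmap] is determined by [JmapP], as [hform] is
   non-degenerate on n_{-1}. *)
Record pseudoHType (R : realType) := PseudoHType {
  pseudoH_lie :> lieAlgType R;
  part2 : {vspace pseudoH_lie};
  part1 : {vspace pseudoH_lie};
  pseudoH_dec : (part2 + part1 = fullv)%VS;
  pseudoH_direct : directv (part2 + part1);
  pseudoH_lie11 : {in part1 &, forall x y, [[x, y]] \in part2};
  pseudoH_central : {in part2, forall z x, [[z, x]] = 0};
  pseudoH_nonabelian : exists x y : pseudoH_lie, [[x, y]] != 0;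
  hform : {symmetric pseudoH_lie};
  hform_orth : {in part2 & part1, forall z x, hform z x = 0};
  hform_nondeg : nondegenerate hform;
  hform_nondeg2 :
    {in part2, forall z, (forall w, w \in part2 -> hform z w = 0) -> z = 0};
  Jmap : subvs_of part2 -> 'End(subvs_of part1);
  JmapP : forall (z : subvs_of part2) (x y : subvs_of part1),
    hform (vsval (Jmap z x)) (vsval y) = hform [[vsval x, vsval y]] (vsval z);
  Jmap_sq : forall z : subvs_of part2,
    (Jmap z \o Jmap z)%VF = - hform (vsval z) (vsval z) *: \1%VF
}.

(* Main.v *)
(* The heights define a grading element E of the Cartan subalgebra: [grading k]
   is the k-eigenspace of [ad E] for k <> 0, so that [ad E] is diagonalizable on
   so(N), with integer eigenvalues at most 2, among which 1 and 2.  On so(N),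
   seen as the exterior square of the standard representation, this forces the
   skew matrix E to be diagonalizable, with eigenvalues -1, 0, 1 of
   multiplicities m, a, m; N being odd, so is a.  Hence dim g_{-2} = m(m-1)/2
   and dim g_{-1} = m a.

   On the other side, an orthogonal basis of n_{-2} yields p = dim n_{-2}
   pairwise anticommuting operators on n_{-1} whose squares are nonzero scalars,
   so that 2^floor(p/2) divides dim n_{-1}.  For p = m(m-1)/2 > 1 this power of
   2 does not divide m, and a is odd. *)
From HB Require Import structures.
Require Import Defs.
From mathcomp Require Import all_boot all_order all_algebra.
From mathcomp Require Import ring zify complex reals.

Set Implicit Arguments.
Unset Strict Implicit.
Unset Printing Implicit Defensive.

Import Order.TTheory GRing.Theory Num.Theory passmx.
Local Open Scope ring_scope.

(** * Families of anticommuting matrices with nonzero scalar squares *)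

Lemma anticomm_mulmx_comm (K : fieldType) d (A B C : 'M[K]_d) :
  A *m B = - (B *m A) -> A *m C = - (C *m A) -> comm_mx A (B *m C).
Proof.
move=> AB hAC; rewrite /comm_mx mulmxA AB mulNmx -(mulmxA B A) hAC mulmxN opprK.
by rewrite mulmxA.
Qed.

Lemma sqr_scalar_unitmx (K : fieldType) d (A : 'M[K]_d) c :
  c != 0 -> A *m A = c%:M -> A \in unitmx.
Proof.
move=> c0 AA; have /mulmx1_unit[] // : A *m (c^-1 *: A) = 1%:M.
by rewrite -scalemxAr AA scale_scalar_mx mulVf.
Qed.

(** Moving B across turns A - r into -(A + r), so these two matrices have equal rank. Their product
    is zero, so the ranks sum to at most d; their difference is an invertible scalar, so the ranks
    sum to at least d. *)
Lemma half_rank_eigenspace (K : numFieldType) d (A B : 'M[K]_d) (r : K) :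
  r != 0 -> A *m A = (r ^+ 2)%:M -> B \in unitmx -> A *m B = - (B *m A) ->
  d = (\rank (eigenspace A r) * 2)%N.
Proof.
move=> r0 AA Bu AB.
have rk : \rank (A - r%:M)%R = \rank (A + r%:M)%R.
  have <- : \rank (B *m (A - r%:M))%R = \rank (A - r%:M)%R.
    by rewrite eqmxMfull // row_full_unit.
  have <- : \rank ((- (A + r%:M)) *m B)%R = \rank (A + r%:M)%R.
    by rewrite mxrankMfree ?row_free_unit // mxrank_opp.
  by rewrite mulmxBr mulNmx mulmxDl AB scalar_mxC opprD opprK.
have le : (\rank (A - r%:M)%R + \rank (A + r%:M)%R <= d)%N.
  apply: mulmx0_rank_max.
  rewrite mulmxBl !mulmxDr AA -scalar_mxM -expr2 scalar_mxC opprD.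
  by rewrite [- _ - _]addrC addrACA !subrr addr0.
have ge : (d <= \rank (A - r%:M)%R + \rank (A + r%:M)%R)%N.
  have r2 : r + r != 0 by rewrite -mulr2n mulrn_eq0.
  have := mxrank_add (A + r%:M) (- (A - r%:M)).
  rewrite mxrank_opp opprB [_%:M - A]addrC addrACA subrr add0r.
  rewrite -raddfD /= -[(r + r)%:M]scalemx1 mxrank_scale_nz // mxrank1.
  by rewrite addnC.
by move: le ge; rewrite -rk /eigenspace mxrank_ker; move: (\rank _) => k; lia.
Qed.

(* If A, B, C_1, ..., C_k is such a family, then A has two eigenspaces, swapped
   by B, and the B C_i restrict to such a family on each of them. *)
Lemma anticommuting_family_dvd (K : numClosedFieldType) d (s : seq 'M[K]_d) :
    pairwise (fun A B => A *m B == - (B *m A)) s ->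
    {in s, forall A, exists2 c, c != 0 & A *m A = c%:M} ->
  (2 ^ (size s)./2 %| d)%N.
Proof.
have [k] := ubnP (size s); elim: k => // k IHk in d s *.
case: s => [|A [|B s] ] //=; rewrite ?dvd1n // !ltnS => sk.
case/andP => /andP[/eqP AB As] /andP[Bs ss] sq.
have [a a0 AA] := sq A (mem_head _ _).
have [b b0 BB] : exists2 b, b != 0 & B *m B = b%:M.
  by apply: sq; rewrite !inE eqxx orbT.
have Bu := sqr_scalar_unitmx b0 BB.
have r0 : sqrtC a != 0 by rewrite sqrtC_eq0.
have := @half_rank_eigenspace _ _ A B (sqrtC a); rewrite sqrtCK.
set U := eigenspace _ _ => /(_ r0 AA Bu AB) dE.
have hAC C : C \in s -> A *m C = - (C *m A) by move=> /(allP As)/eqP.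
have hBC C : C \in s -> B *m C = - (C *m B) by move=> /(allP Bs)/eqP.
(* B C commutes with A, since both factors anticommute with it; hence it preserves the eigenspaces
   of A. *)
have stU C : C \in s -> stablemx (row_base U) (B *m C).
  move=> Cs; rewrite stablemx_row_base comm_mx_stable_ker //.
  apply: comm_mx_sym; apply: comm_mxB.
    by apply: comm_mx_sym; apply: anticomm_mulmx_comm => //; apply: hAC.
  by apply: comm_mx_sym; apply: comm_scalar_mx.
suff: (2 ^ (size s)./2 * 2 %| \rank U * 2)%N by rewrite -expnSr -dE.
rewrite dvdn_pmul2r //.
rewrite -(size_map (fun C => restrictmx U (B *m C)) s); apply: IHk.
- by rewrite size_map; apply: leq_trans sk.
- rewrite pairwise_map.
  apply: (sub_in_pairwise (P := [in s])) ss => [C C'|]; last exact/allP.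
  move=> Cs C's /eqP CC' /=.
  rewrite -!conjmxM ?inE ?stU //.
  (* (B X)(B Y) = -b X Y, so the products inherit both anticommutation and nonzero scalar squares
     from [s]. *)
  have mulBB X Y : X \in s -> B *m X *m (B *m Y) = - (b *: (X *m Y)).
    move=> Xs; rewrite mulmxA -(mulmxA B X B) -[X *m B]opprK -hBC //.
    by rewrite mulmxN mulNmx mulmxA BB -mulmxA mul_scalar_mx.
  by rewrite !mulBB // CC' scalerN /conjmx mulmxN mulNmx.
- move=> _ /mapP[C Cs ->].
  have [c c0 CC] : exists2 c, c != 0 & C *m C = c%:M.
    by apply: sq; rewrite !inE Cs !orbT.
  exists (- (b * c)); first by rewrite oppr_eq0 mulf_neq0.
  rewrite -conjmxM ?inE ?stU // mulmxA -(mulmxA B C B) -[C *m B]opprK -hBC //.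
  rewrite mulmxN mulNmx mulmxA BB -mulmxA mul_scalar_mx CC scale_scalar_mx.
  by rewrite -raddfN conjmx_scalar ?row_base_free.
Qed.

(** * Clifford modules and the divisibility for pseudo H-type algebras *)

Lemma symmetric_formC (K : fieldType) (V : vectType K) (b : {symmetric V}) x y :
  b x y = b y x.
Proof. by rewrite hermC mul1r. Qed.

(** Gram-Schmidt for a possibly indefinite form. A non-isotropic vector exists because two isotropic
    vectors v, w with b(v,w) nonzero give b(v+w,v+w) = 2 b(v,w). Its orthogonal complement in U is
    again non-degenerate and has dimension one less. *)
Lemma nondeg_orthogonal_family (K : numFieldType) (V : vectType K)
    (b : {symmetric V}) (U : {vspace V}) :
    {in U, forall z, (forall w, w \in U -> b z w = 0) -> z = 0} ->
  exists s : seq V, [/\ size s = \dim U, {subset s <= U},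
    {in s, forall z, b z z != 0} & pairwise (fun z w => b z w == 0) s].
Proof.
have [k] := ubnP (\dim U); elim: k => // k IHk in U *; rewrite ltnS => Uk Und.
have [U0|Un0] := eqVneq (\dim U) 0%N; first by exists [::]; rewrite U0.
have [v vU v0] : exists2 v, v \in U & v != 0.
  by exists (vpick U); rewrite ?memv_pick // vpick0 -dimv_eq0.
have [w wU bvw] : exists2 w, w \in U & b v w != 0.
  apply/mem_orthovPn; apply: contraNN v0 => /mem_orthovP vo.
  by apply/eqP/Und.
have [z zU bz] : exists2 z, z \in U & b z z != 0.
  have [bv|] := eqVneq (b v v) 0; last by exists v.
  have [bw|] := eqVneq (b w w) 0; last by exists w.
  exists (v + w); first exact: rpredD.
  rewrite linearDl !linearDr /= bv bw add0r addr0 (symmetric_formC b w).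
  by rewrite -mulr2n mulrn_eq0.
pose U' := (U :&: orthov b <[z]>)%VS.
have dU' : \dim U' = (\dim U).-1.
  by rewrite -eq_dim_orthov1 //; apply/mem_orthovPn; exists z.
have [||s [ss sU' bs ps] ] := IHk U'.
- by rewrite dU'; move: Un0 Uk; lia.
- move=> x; rewrite memv_cap mem_orthov1 => /andP[xU /eqP xz] xU'.
  apply: Und => // y yU.
  (* As x is orthogonal to z, it pairs with y as with the projection of y to the orthogonal
     complement of z. *)
  have := xU' (y - (b y z / b z z) *: z).
  rewrite linearBr linearZr /= xz mulr0 subr0; apply.
  rewrite memv_cap rpredB ?rpredZ // mem_orthov1.
  by rewrite linearBl linearZl_LR /= divfK ?subrr.
exists (z :: s); split => /=.
- by rewrite ss dU' prednK // lt0n.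
- by move=> x /predU1P[->|/sU'] //; rewrite memv_cap => /andP[].
- by move=> x /predU1P[->|/bs].
- rewrite ps andbT; apply/allP => x /sU'; rewrite memv_cap => /andP[_].
  by rewrite mem_orthov1 symmetric_formC.
Qed.

(** Complexification: the operators become matrices over R[i], where the square roots needed for
    eigenspaces exist. [mxof] reverses composition, which is harmless since anticommutation is
    symmetric in the two operators. *)
Lemma real_anticommuting_family_dvd (R : rcfType) (V : vectType R)
    (s : seq 'End(V)) :
    pairwise (fun f g => (f \o g)%VF == - (g \o f)%VF) s ->
    {in s, forall f, exists2 c : R, c != 0 & (f \o f)%VF = c *: \1%VF} ->
  (2 ^ (size s)./2 %| \dim {:V})%N.
Proof.
move=> ps sq; have e_basis := vbasisP {:V}; set e := vbasis {:V} in e_basis.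
pose M (f : 'End(V)) : 'M[R[i]]_(\dim {:V}) :=
  map_mx (real_complex R) (mxof e e f).
have MM f g : M (f \o g)%VF = M g *m M f.
  by rewrite /M (mxof_comp _ _ e_basis) // map_mxM.
rewrite -(size_map M s); apply: anticommuting_family_dvd.
  rewrite pairwise_map; apply: sub_pairwise ps => f g /eqP fg /=.
  by rewrite -!MM fg /M raddfN map_mxN opprK.
move=> _ /mapP[f /sq[c c0 ff] ->]; exists (real_complex R c).
  by rewrite fmorph_eq0.
rewrite -MM ff /M linearZ /= mxof1 ?(basis_free e_basis) //.
by rewrite scalemx1 map_scalar_mx.
Qed.

(** Polarising the identity for the squares at z + w shows that J z and J w anticommute when z and w
    are orthogonal; an orthogonal basis of U thus yields an anticommuting family. *)
Lemma clifford_module_dvd (R : rcfType) (V W : vectType R) (b : {symmetric V})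
    (U : {vspace V}) (J : subvs_of U -> 'End(W)) :
    {in U, forall z, (forall w, w \in U -> b z w = 0) -> z = 0} ->
    {morph J : z w / z + w} ->
    (forall z, (J z \o J z)%VF = - b (vsval z) (vsval z) *: \1%VF) ->
  (2 ^ (\dim U)./2 %| \dim {:W})%N.
Proof.
move=> nd JD Jsq.
have [s [ss sU sq ps] ] := nondeg_orthogonal_family nd.
have anti (z w : subvs_of U) : b (vsval z) (vsval w) = 0 ->
    (J z \o J w)%VF = - (J w \o J z)%VF.
  move=> zw; have := Jsq (z + w).
  rewrite JD comp_lfunDl !comp_lfunDr !Jsq raddfD /=.
  rewrite !linearDl /= (symmetric_formC _ (vsval w) (vsval z)) zw.
  rewrite addr0 add0r opprD scalerDl addrACA [X in _ + X]addrC addrACA.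
  by move=> /(canRL (addKr _))/eqP; rewrite addNr addrC addr_eq0 => /eqP.
have := @real_anticommuting_family_dvd R W [seq J (vsproj U z) | z <- s].
rewrite size_map ss; apply.
  rewrite pairwise_map; apply: (sub_in_pairwise (P := [in U])) ps.
    by move=> z w z2 w2 /= /eqP zw; rewrite anti // !vsprojK.
  exact/allP.
move=> _ /mapP[z zs ->]; exists (- b z z); first by rewrite oppr_eq0 sq.
by rewrite Jsq vsprojK // sU.
Qed.

(** What remains to be checked is that [Jmap] is additive. It follows from [JmapP] once the form is
    known to be non-degenerate on [part1], which holds because [part1] is orthogonal to [part2] and
    the two span the algebra. *)
Lemma pseudoH_dim_dvd (R : realType) (N : pseudoHType R) :
  (2 ^ (\dim (part2 N))./2 %| \dim (part1 N))%N.
Proof.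
have bB (x y : subvs_of (part1 N)) z :
    hform N (vsval (x - y)) z = hform N (vsval x) z - hform N (vsval y) z.
  by rewrite raddfB; exact: linearBl.
have bD (x y : subvs_of (part1 N)) z :
    hform N (vsval (x + y)) z = hform N (vsval x) z + hform N (vsval y) z.
  by rewrite raddfD; exact: linearDl.
have nd1 (x : subvs_of (part1 N)) :
    (forall y : subvs_of (part1 N), hform N (vsval x) (vsval y) = 0) -> x = 0.
  move=> x0; apply/val_inj => /=.
  suff : vsval x \in orthov (hform N) fullv.
    by rewrite (eqP (hform_nondeg N)) memv0 => /eqP.
  apply/mem_orthovP => y; rewrite -(pseudoH_dec N).
  move=> /memv_addP[z z2 [w w1 ->] ].
  rewrite linearDr /= -[w](vsprojK w1) x0 addr0 symmetric_formC.
  by rewrite (hform_orth z2) // subvsP.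
have := @clifford_module_dvd R N _ (hform N) (part2 N) (@Jmap R N).
rewrite dimvf; apply; [exact: hform_nondeg2 | | exact: Jmap_sq].
move=> z w; apply/lfunP => x; apply/eqP; rewrite -subr_eq0; apply/eqP/nd1 => y.
rewrite add_lfunE bB bD !JmapP.
by rewrite raddfD subrr.
Qed.

(** * Weight bases with respect to a Cartan subalgebra *)

Section LieBasics.
Variables (K : fieldType) (L : lieAlgType K).
Implicit Types x y z : L.

(** Named so that linearity of the bracket in its first argument can be registered as an
    instance. *)
Definition lier y : L -> L := fun x => [[x, y]].

HB.instance Definition _ y :=
  GRing.isLinear.Build K L L *:%R (lier y) (lie_linearl y).

Lemma lieDl x y z : [[x + y, z]] = [[x, z]] + [[y, z]].
Proof. exact: (linearD (lier z)). Qed.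

Lemma lieC x y : [[x, y]] = - [[y, x]].
Proof.
have := liexx (x + y); rewrite lieDl !linearD /= !liexx add0r addr0.
by move/eqP; rewrite addr_eq0 => /eqP.
Qed.

Lemma ad_comm x y : [[x, y]] = 0 -> (ad x \o ad y)%VF = (ad y \o ad x)%VF.
Proof.
move=> xy; apply/lfunP => z; rewrite !comp_lfunE !lfunE /=.
have := lie_jacobi x y z; rewrite (lieC z [[x, y]]) xy.
have -> : [[0, z]] = 0 := linear0 (lier z).
rewrite oppr0 addr0 (lieC z x) linearN /= => /eqP.
by rewrite subr_eq0 => /eqP.
Qed.

End LieBasics.

Section WeightBasis.
Variables (K : fieldType) (L : lieAlgType K).

Lemma mxof_diagonalizable (V : vectType K) (E : (\dim {:V}).-tuple V)
    (f : 'End(V)) :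
  basis_of fullv E -> diagonalizable_end f -> diagonalizable (mxof E E f).
Proof.
move=> Eb [e eb ev]; pose P := mxof e E \1%VF.
have PQ : P *m mxof E e \1%VF = 1%:M.
  by rewrite -mxof_comp // comp_lfun1l mxof1 // (basis_free eb).
have [Pu _] := mulmx1_unit PQ.
exists P => //; apply/diagonalizable_forP => // i j ij.
have -> : P *m mxof E E f = mxof e e f *m P.
  by rewrite -!mxof_comp // comp_lfun1l comp_lfun1r.
rewrite mulmxK // /mxof mxE /= vecof_delta.
have [c] := ev i; rewrite (tnth_nth 0) => ->; rewrite linearZ /=.
by rewrite !mxE coord_free ?(basis_free eb) // -val_eqE /= (negPf ij) mulr0.
Qed.

(** The operators ad H, for H in h, commute and are diagonalizable, hence are simultaneously
    diagonalizable. Weights may be zero here, so they need not all be roots. *)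
Lemma weight_basis (h : {vspace L}) : cartan_subalgebra h ->
  exists e : (\dim {:L}).-tuple L, exists a : 'I_(\dim {:L}) -> dual h,
    basis_of fullv e /\ forall i : 'I_(\dim {:L}), e`_i \in root_space (a i).
Proof.
move=> [hab _ hdiag]; have Eb := vbasisP {:L}; set E := vbasis {:L} in Eb.
pose Ms := [seq mxof E E (ad (vsval b)) | b <- vbasis {:subvs_of h}].
have [|P Pu /allP Pd] := (codiagonalizableP Ms).1.
  split=> [_ _ /mapP[x _ ->] /mapP[y _ ->]|_ /mapP[x _ ->] ].
    rewrite /comm_mx -!mxof_comp // ad_comm //.
    by apply: hab; exact: subvsP.
  by apply: mxof_diagonalizable => //; apply/hdiag/subvsP.
pose e := [tuple vecof E (row i P) | i < \dim {:L}].
have eE (i : 'I_(\dim {:L})) : e`_i = vecof E (row i P).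
  by rewrite -tnth_nth tnth_mktuple.
have efree : free e.
  apply/freeP => k; under eq_bigr do rewrite eE -linearZ.
  rewrite -linear_sum /= => /eqP; rewrite vecof_eq0 //.
  have -> : \sum_i k i *: row i P = (\row_i k i) *m P.
    by rewrite mulmx_sum_row; apply: eq_bigr => i _; rewrite mxE.
  move=> /eqP kP i; have := congr1 (fun u => (u *m invmx P) 0 i) kP.
  by rewrite mulmxK // mul0mx !mxE.
have eb : basis_of fullv e by rewrite basisEfree efree subvf size_tuple /=.
have ce (i : 'I_(\dim {:L})) : coord e i e`_i = 1 by rewrite coord_free // eqxx.
have eig_basis b (i : 'I_(\dim {:L})) : b \in vbasis {:subvs_of h} ->
    [[vsval b, e`_i]] = coord e i [[vsval b, e`_i]] *: e`_i.
  move=> /(map_f (fun b => mxof E E (ad (vsval b)))) /Pd /=.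
  move/(diagonalizable_forPex)=> [d /(simmxPp (stablemx_unit _ Pu)) PM].
  suff -> : [[vsval b, e`_i]] = d 0 i *: e`_i by rewrite linearZ /= ce mulr1.
  rewrite eE.
  have <- : ad (vsval b) (vecof E (row i P)) = [[vsval b, vecof E (row i P)]].
    by rewrite lfunE.
  rewrite (@hom_vecof _ _ _ E E) // -linearZ /=; congr vecof.
  by rewrite -row_mul PM row_mul row_diag_mx -scalemxAl -rowE.
have lieE (i : 'I_(\dim {:L})) (H : subvs_of h) :
    [[vsval H, e`_i]] = (lier e`_i \o vsval) H by [].
have eig (i : 'I_(\dim {:L})) (H : subvs_of h) :
    [[vsval H, e`_i]] = coord e i [[vsval H, e`_i]] *: e`_i.
  rewrite (coord_vbasis (memvf H)) lieE !linear_sum scaler_suml.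
  apply: eq_bigr => j _; rewrite !linearZ /= -scalerA /lier -eig_basis //.
  by rewrite mem_nth ?size_tuple.
(* The weight is read off as the i-th coordinate of [H, e_i], which is visibly linear in H. *)
pose a i : {linear subvs_of h -> K^o} := coord e i \o (lier e`_i \o vsval).
exists e, (fun i => linfun (a i)); split=> // i.
by apply/mem_root_space => H; rewrite lfunE.
Qed.

End WeightBasis.

(** * The grading element of the Cartan subalgebra *)

Section GradingElement.
Variables (K : numFieldType) (L : lieAlgType K) (D : rootDatum L).
Variable Sigma : {set 'I_(rank D)}.

Lemma ht_linear : linear (ht Sigma : _ -> K^o).
Proof.
move=> c a b; rewrite /ht scaler_sumr -big_split /=.
by apply: eq_bigr => i _; rewrite linearP.
Qed.

HB.instance Definition _ :=
  GRing.isLinear.Build K (dual (cartan D)) K^o *:%R (ht Sigma) ht_linear.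

(** Biduality: the height is a linear form on the dual of the Cartan subalgebra, so it is evaluation
    at some E. The coordinates of E are the heights of the dual basis. *)
Lemma grading_element : exists E : subvs_of (cartan D),
  forall a : dual (cartan D), a E = ht Sigma a.
Proof.
set B := vbasis {:subvs_of (cartan D)}.
pose d j : dual (cartan D) := linfun (coord B j : {linear _ -> K^o}).
exists (\sum_j ht Sigma (d j) *: B`_j) => a.
have -> : ht Sigma a = ht Sigma (\sum_(j < _) (a B`_j : K) *: d j).
  congr ht; apply/lfunP => H; rewrite sum_lfunE {1}(coord_vbasis (memvf H)).
  rewrite linear_sum; apply: eq_bigr => j _.
  by rewrite linearZ scale_lfunE lfunE; exact: mulrC.
rewrite !linear_sum; apply: eq_bigr => j _.
by rewrite !linearZ; exact: mulrC.
Qed.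

Lemma ht_simple i : ht Sigma (tnth (simple D) i) = (i \in Sigma)%:R.
Proof.
have sb := simple_basis D.
rewrite /ht (tnth_nth 0); have [iS|iS] := boolP (i \in Sigma).
  rewrite (bigD1 i) //= coord_free ?(basis_free sb) // eqxx big1 ?addr0 //.
  move=> j /andP[_ ji].
  by rewrite coord_free ?(basis_free sb) // eq_sym (negPf ji).
rewrite big1 // => j jS; rewrite coord_free ?(basis_free sb) //.
by have [ij|//] := eqVneq i j; move: iS; rewrite ij jS.
Qed.

(** The difference t - a is a sum of simple roots with natural coefficients, and each simple root
    has height 0 or 1. *)
Lemma ht_root_int_le2 t a :
  highest_root t -> ht Sigma t = 2 -> a \in Defs.roots D ->
  exists n : nat, ht Sigma a = 2 - n%:R.
Proof.
move=> [_ thigh] t2 /thigh[c ta].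
exists (\sum_i c i * (i \in Sigma))%N; rewrite -t2.
suff <- : ht Sigma t - ht Sigma a = (\sum_i c i * (i \in Sigma))%:R.
  by rewrite subKr.
rewrite -linearB /= ta linear_sum natr_sum /=; apply: eq_bigr => i _.
by rewrite linearMn /= ht_simple natrM mulr_natl.
Qed.

(** These five properties carry all that is later used about the root datum. The first says that ad
    E has no Jordan block of size two, the second that its eigenvalues are integers at most 2; then
    1 and 2 occur as eigenvalues, and the nonzero degrees are the eigenspaces. *)
Lemma abs2_grading_element : is_abs2_grading Sigma ->
  exists E : L,
  [/\ forall (c : K) x, [[E, [[E, x]] - c *: x]] = c *: ([[E, x]] - c *: x) ->
        [[E, x]] = c *: x,
      forall (c : K) x, x != 0 -> [[E, x]] = c *: x ->
        exists n : nat, c = 2 - n%:R,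
      exists2 x, x != 0 & [[E, x]] = x,
      exists2 x, x != 0 & [[E, x]] = 2 *: x
    & forall (k : int) x, k != 0 ->
        x \in grading Sigma k <-> [[E, x]] = k%:~R *: x].
Proof.
move=> [t thigh t2]; have [E hE] := grading_element.
have [e [a [eb ea] ] ] := weight_basis (cartanP D).
have efree := basis_free eb.
have rootE b x : x \in root_space b -> [[vsval E, x]] = ht Sigma b *: x.
  by move=> /mem_root_space ->; rewrite hE.
have [root_vec ht_vec] : (forall b, b \in Defs.roots D ->
    exists2 x, x != 0 & [[vsval E, x]] = ht Sigma b *: x) /\
    forall i, ht Sigma (a i) != 0 -> a i \in Defs.roots D.
  split=> [b|i hi]; rewrite rootsP inE.
    move=> /andP[_ b0]; exists (vpick (root_space b)); first by rewrite vpick0.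
    by apply: rootE; exact: memv_pick.
  apply/andP; split; first by apply: contraNneq hi => ->; rewrite linear0.
  apply: contraTneq (ea i) => ->; rewrite memv0.
  by rewrite (free_not0 efree) // mem_nth ?size_tuple.
(* In the weight basis ad E is diagonal, with the heights of the weights as entries. *)
have lieEE x i : coord e i [[vsval E, x]] = ht Sigma (a i) * coord e i x.
  rewrite {1}(coord_basis eb (memvf x)) !linear_sum /=.
  rewrite (bigD1 i) //= big1 ?addr0 => [|j ji]; rewrite !linearZ /=.
    by rewrite (rootE _ _ (ea i)) linearZ /= coord_free // eqxx mulr1 mulrC.
  by rewrite (rootE _ _ (ea j)) linearZ /= coord_free // (negPf ji) !mulr0.
have coord_inj x y : (forall i, coord e i x = coord e i y) -> x = y.
  move=> xy; rewrite (coord_basis eb (memvf x)) (coord_basis eb (memvf y)).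
  by apply: eq_bigr => i _; rewrite xy.
have eigP (c : K) x : [[vsval E, x]] = c *: x <->
    forall i, coord e i x != 0 -> ht Sigma (a i) = c.
  split=> [xc i xi|xc].
    have := congr1 (coord e i) xc; rewrite lieEE linearZ /=.
    exact/mulIf.
  apply: coord_inj => i; rewrite lieEE linearZ /=.
  by have [->|/xc ->//] := eqVneq (coord e i x) 0; rewrite !mulr0.
exists (vsval E); split.
- move=> c x /eigP xc; apply/eigP => i xi; apply/eqP/negPn/negP => hc.
  move/negP: (hc); apply; apply/eqP/xc.
  by rewrite linearB /= lieEE linearZ /= -mulrBl mulf_neq0 // subr_eq0.
- move=> c x x0 /eigP xc.
  have [i xi] : exists i, coord e i x != 0.
    apply/existsP; rewrite -negb_forall; apply: contra x0 => /forallP x0.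
    by apply/eqP/coord_inj => i; rewrite linear0; apply/eqP.
  rewrite -(xc i xi); have [->|/ht_vec] := eqVneq (ht Sigma (a i)) 0.
    by exists 2%N; rewrite subrr.
  exact: (ht_root_int_le2 thigh t2).
(* An empty Sigma would give the highest root height 0 rather than 2; any simple root in Sigma then
   has height 1. *)
- have [i iS] : exists i, i \in Sigma.
    apply/existsP; apply: contraT; rewrite negb_exists => /forallP S0.
    move: t2; rewrite /ht big1 => [/eqP|i]; first by rewrite eq_sym pnatr_eq0.
    by rewrite (negPf (S0 i)).
  have [x x0 xE] := root_vec _ (simple_roots (mem_tnth i (simple D))).
  by exists x => //; rewrite xE ht_simple iS scale1r.
- by rewrite -t2; apply: root_vec; case: thigh.
- move=> k x k0; rewrite /grading (negPf k0) addv0; split=> [|/eigP xk].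
    pose W := lker (ad (vsval E) - (k%:~R : K) *: \1%VF).
    have memW y : (y \in W) = ([[vsval E, y]] == (k%:~R : K) *: y).
      rewrite memv_ker add_lfunE opp_lfunE scale_lfunE id_lfunE lfunE /=.
      by rewrite subr_eq0.
    move=> xk; apply/eqP; rewrite -memW; apply: subvP x xk.
    apply: (big_ind (fun U => U <= W)%VS) => [|U1 U2|b /eqP bk].
    + exact: sub0v.
    + by rewrite subv_add => -> ->.
    + by apply/subvP => y yb; rewrite memW (rootE b) // bk.
  rewrite (coord_basis eb (memvf x)) rpred_sum // => i _.
  have [->|xi] := eqVneq (coord e i x) 0; first by rewrite scale0r mem0v.
  apply/rpredZ; have ai := xk i xi.
  have ar : a i \in Defs.roots D by apply: ht_vec; rewrite ai intr_eq0.
  rewrite (big_rem (a i)) //= ai eqxx; apply: (subvP (addvSl _ _)); exact: ea.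
Qed.

End GradingElement.

(** * Skew matrices as bivectors *)

Section Wedge.
Variables (K : fieldType) (N : nat).
Implicit Types v w x : 'rV[K]_N.

(** The bivector of v and w under the identification of the exterior square with skew matrices. *)
Definition wedge v w : 'M[K]_N := v^T *m w - w^T *m v.

Lemma wedge_so v w : wedge v w \in so_space K N.
Proof. by apply/so_spaceP; rewrite linearB /= !trmx_mul !trmxK opprB. Qed.

Lemma wedgeDl v v' w : wedge (v + v') w = wedge v w + wedge v' w.
Proof. by rewrite /wedge linearD /= mulmxDl mulmxDr opprD addrACA. Qed.

Lemma wedgeZl c v w : wedge (c *: v) w = c *: wedge v w.
Proof. by rewrite /wedge linearZ /= -scalemxAl -scalemxAr scalerBr. Qed.

Lemma wedgeZr c v w : wedge v (c *: w) = c *: wedge v w.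
Proof. by rewrite /wedge !linearZ /= -scalemxAl scalerBr. Qed.

Lemma wedge_eq0 v w : w != 0 -> wedge v w = 0 -> exists c, v = c *: w.
Proof.
move=> /rV0Pn[j wj] /eqP; rewrite subr_eq0 => /eqP vw.
exists (v 0 j / w 0 j); apply/rowP => i; rewrite mxE mulrAC.
apply: (canRL (mulfK wj)).
by move/matrixP/(_ i j): vw; rewrite !mxE !big_ord1 !mxE [RHS]mulrC.
Qed.

(** The adjoint action is the exterior square of the standard representation: M acts on bivectors as
    a derivation, and on row vectors through its transpose. *)
Lemma commutator_wedge (M : 'M[K]_N) v w : M^T = - M ->
  commutator M (wedge v w) = wedge (v *m M^T) w + wedge v (w *m M^T).
Proof.
move=> skM; rewrite /commutator /wedge mulmxBr mulmxBl !trmx_mul trmxK skM.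
rewrite !mulmxN !mulmxA !opprK.
move: (M *m _ *m w) (M *m _ *m v) (_ *m v *m M) (_ *m w *m M) => X Y Z T.
apply/matrixP => i j; rewrite !mxE; ring.
Qed.

Lemma wedge_eigen (M : 'M[K]_N) v w a b : M^T = - M ->
    v *m M^T = a *: v -> w *m M^T = b *: w ->
  commutator M (wedge v w) = (a + b) *: wedge v w.
Proof.
by move=> skM va wb; rewrite commutator_wedge // va wb wedgeZl wedgeZr scalerDl.
Qed.

Lemma wedge_eigen_neq0 (A : 'M[K]_N) v w a b : a != b -> v != 0 -> w != 0 ->
  v *m A = a *: v -> w *m A = b *: w -> wedge v w != 0.
Proof.
move=> ab v0 w0 va wb; apply/eqP => /(wedge_eq0 w0)[c vE].
move: va; rewrite vE -scalemxAl wb scalerA mulrC -scalerA -vE => /eqP.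
by rewrite -subr_eq0 -scalerBl scaler_eq0 (negPf v0) subr_eq0 eq_sym (negPf ab).
Qed.

End Wedge.

Section EigenCoordinates.
Variables (K : fieldType) (N : nat) (M P : 'M[K]_N) (d : 'rV[K]_N).
Hypotheses (skM : M^T = - M) (Pu : P \in unitmx).
Hypothesis PM : P *m M^T = diag_mx d *m P.

(** The matrix Y with X = P^T Y P. For skew X, its entry (i, j) with i < j is the coefficient of X
    at the bivector of rows i and j of P. *)
Definition wedge_coord (X : 'M[K]_N) := (invmx P)^T *m X *m invmx P.

Lemma wedge_coordK : cancel wedge_coord (fun Y => P^T *m Y *m P).
Proof.
move=> X; rewrite /wedge_coord !mulmxA -trmx_mul mulVmx // trmx1 mul1mx.
by rewrite -mulmxA mulVmx ?mulmx1.
Qed.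

Lemma wedge_coord_linear : linear wedge_coord.
Proof.
by move=> c X Y; rewrite /wedge_coord mulmxDr -scalemxAr mulmxDl -scalemxAl.
Qed.

Lemma wedge_coord_skew X i j :
  X^T = - X -> wedge_coord X j i = - wedge_coord X i j.
Proof.
move=> skX.
have -> : wedge_coord X j i = (wedge_coord X)^T i j by rewrite [RHS]mxE.
rewrite /wedge_coord !trmx_mul trmxK skX mulNmx mulmxN mulmxA.
by rewrite [LHS]mxE.
Qed.

Lemma wedge_coord_commutator X i j :
  wedge_coord (commutator M X) i j = (d 0 i + d 0 j) * wedge_coord X i j.
Proof.
have MQ : M^T *m invmx P = invmx P *m diag_mx d.
  by apply: (canRL (mulKmx Pu)); rewrite mulmxA PM mulmxK.
have QM : (invmx P)^T *m M = diag_mx d *m (invmx P)^T.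
  by rewrite -[M]trmxK -trmx_mul MQ trmx_mul tr_diag_mx.
have -> : wedge_coord (commutator M X)
    = diag_mx d *m wedge_coord X + wedge_coord X *m diag_mx d.
  have MQ' : M *m invmx P = - (invmx P *m diag_mx d).
    by rewrite -MQ skM mulNmx opprK.
  rewrite /wedge_coord /commutator mulmxBr mulmxBl !mulmxA QM.
  by rewrite -(mulmxA _ M (invmx P)) MQ' mulmxN opprK !mulmxA.
rewrite mul_diag_mx mul_mx_diag; move: (wedge_coord X) => Y.
by rewrite !mxE mulrDl [Y i j * _]mulrC.
Qed.

Lemma row_eigen i : row i P *m M^T = d 0 i *: row i P.
Proof. by rewrite -row_mul PM row_mul row_diag_mx -scalemxAl -rowE. Qed.

Lemma row_unitmx_neq0 i : row i P != 0.
Proof.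
apply/eqP => Pi; have := congr1 (fun u => (u *m invmx P) 0 i) Pi.
by rewrite rowE mulmxK // mul0mx !mxE !eqxx => /eqP; rewrite oner_eq0.
Qed.

Lemma eigenvalue_diag i : eigenvalue M^T (d 0 i).
Proof.
apply/eigenvalueP; exists (row i P); first exact: row_eigen.
exact: row_unitmx_neq0.
Qed.

Lemma wedge_coord_neq0 X : X != 0 -> exists i j, wedge_coord X i j != 0.
Proof.
move=> X0; have /matrix0Pn[i [j ij] ] : wedge_coord X != 0; last by exists i, j.
apply: contraNneq X0 => Y0.
by rewrite -[X]wedge_coordK Y0 mulmx0 mul0mx.
Qed.

Lemma wedge_coord_wedge i j k l :
  wedge_coord (wedge (row i P) (row j P)) k l
  = ((k == i) && (l == j))%:R - ((k == j) && (l == i))%:R.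
Proof.
have PQ m : row m P *m invmx P = delta_mx 0 m by rewrite rowE mulmxK.
rewrite /wedge_coord /wedge mulmxBr mulmxBl !mulmxA -!trmx_mul !PQ.
by rewrite -!mulmxA !PQ !trmx_delta !mul_delta_mx !mxE.
Qed.

End EigenCoordinates.

(** * The spectrum of the grading element as a skew matrix of odd size *)

Section SkewMatrix.
Variables (K : numClosedFieldType) (N : nat) (M : 'M[K]_N.+1).
Hypothesis skM : M^T = - M.
Hypothesis oddN : odd N.+1.
(* [eigenvalue] refers to row vectors, on which M acts through its transpose. *)
Let A := M^T.
Let skew (X : 'M[K]_N.+1) := X^T = - X.

(** This and the next three hypotheses restate for matrices the properties of E in
    [abs2_grading_element]. *)
Hypothesis ad_ss : forall (c : K) X, skew X ->
  commutator M (commutator M X - c *: X) = c *: (commutator M X - c *: X) ->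
  commutator M X = c *: X.
Hypothesis ad_eig : forall (c : K) X, skew X -> X != 0 ->
  commutator M X = c *: X -> exists n : nat, c = 2 - n%:R.
Hypothesis ad_eig1 : exists X, [/\ skew X, X != 0 & commutator M X = X].
Hypothesis ad_eig2 : exists X, [/\ skew X, X != 0 & commutator M X = 2 *: X].

(** A skew matrix of odd size satisfies det A = -det A, hence is singular. *)
Lemma eigenvalue_zero : eigenvalue A 0.
Proof.
rewrite /eigenvalue /eigenspace kermx_eq0 raddf0 subr0 row_free_unit unitmxE.
rewrite unitfE negbK.
have : \det A = - \det A.
  rewrite /A det_tr -[M in LHS]opprK -skM -scaleN1r detZ -signr_odd oddN.
  by rewrite expr1 mulN1r det_tr.
by move=> /eqP; rewrite -addr_eq0 -mulr2n mulrn_eq0.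
Qed.

Lemma eigenvalue_opp c : eigenvalue A c -> eigenvalue A (- c).
Proof.
rewrite /eigenvalue /eigenspace !kermx_eq0 !row_free_unit.
have -> : A - (- c)%:M = - (A - c%:M)^T.
  by rewrite linearB /= tr_scalar_mx /A trmxK skM raddfN opprB opprK addrC.
by rewrite -[- _^T]scaleN1r unitmxZ ?unitrN1 // unitmx_tr.
Qed.

Lemma mxminpoly_split :
  exists s : seq K, mxminpoly A = \prod_(r <- s) ('X - r%:P).
Proof.
have [s sE] := closed_field_poly_normal (mxminpoly A).
by exists s; rewrite sE (monicP (mxminpoly_monic A)) scale1r.
Qed.

(** Otherwise A is nilpotent. An X of degree 2 satisfies X A = (A + 2) X, so X A^k = (A + 2)^k X;
    for large k the left side vanishes while A + 2 is invertible, forcing X = 0. *)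
Lemma eigenvalue_neq0 : exists2 c, c != 0 & eigenvalue A c.
Proof.
have [s sE] := mxminpoly_split.
have seig c : c \in s = eigenvalue A c.
  by rewrite eigenvalue_root_min sE root_prod_XsubC.
have [s0|/allPn[c] ] := boolP (all (pred1 0) s); last first.
  by rewrite seig => ce c0; exists c.
have [X [skX X0 XE] ] := ad_eig2.
have XA : X *m A = (A + 2%:M) *m X.
  rewrite mulmxDl mul_scalar_mx -XE /commutator /A skM mulNmx mulmxN.
  by rewrite addrA addNr add0r.
have XAk k : X *m (A ^+ k) = (A + 2%:M) ^+ k *m X.
  elim: k => [|k IHk]; first by rewrite !expr0 mulmx1 mul1mx.
  rewrite exprSr exprS -mulmxE mulmxA IHk -mulmxA XA mulmxA mulmxE.
  by rewrite -exprSr exprS.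
have A0 : A ^+ (size s) = 0.
  have := mx_root_minpoly A; rewrite sE.
  rewrite (eq_big_seq (fun=> 'X)); last first.
    by move=> r /(allP s0)/eqP ->; rewrite subr0.
  by rewrite big_const_seq count_predT iter_mulr_1 rmorphXn /= horner_mx_X.
exfalso; move/negP: X0; apply; apply/eqP.
have Au : A + 2%:M \is a GRing.unit.
  apply/negPn/negP => Au; have : eigenvalue A (- 2).
    by rewrite /eigenvalue kermx_eq0 row_free_unit raddfN opprK.
  by rewrite -seig => /(allP s0) /=; rewrite oppr_eq0 pnatr_eq0.
have := XAk (size s); rewrite A0 mulmx0.
move=> /esym/(congr1 (mulmx ((A + 2%:M) ^- size s))).
by rewrite mulmx0 mulmxA mulmxE mulVr ?unitrX // mul1r.
Qed.

(* If x is an eigenvector for b <> c and v = w (A - c), then [ad M - (b + c)]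
   maps [wedge w x] to [wedge v x] and kills the latter; as [ad M] is
   diagonalizable, [wedge v x] vanishes, hence so does v. *)
Lemma eigen_semisimple c (w : 'rV_N.+1) :
  w *m (A - c%:M) *m (A - c%:M) = 0 -> w *m (A - c%:M) = 0.
Proof.
move=> w2.
have [b bc /eigenvalueP[x xA x0] ] : exists2 b : K, c != b & eigenvalue A b.
  have [->|c0] := eqVneq c 0; last by exists 0 => //; exact: eigenvalue_zero.
  by have [b b0 Ab] := eigenvalue_neq0; exists b; rewrite // eq_sym.
set v := w *m _ in w2 *.
have wA : w *m A = v + c *: w by rewrite /v mulmxBr mul_mx_scalar subrK.
have vA : v *m A = c *: v.
  by move: w2; rewrite mulmxBr mul_mx_scalar => /eqP; rewrite subr_eq0 => /eqP.
have [//|v0] := eqVneq v 0.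
have /negP[] := wedge_eigen_neq0 bc v0 x0 vA xA.
have adE : commutator M (wedge w x) = wedge v x + (c + b) *: wedge w x.
  rewrite commutator_wedge // -/A wA xA wedgeDl wedgeZl wedgeZr.
  by rewrite -addrA scalerDl.
have := ad_ss (so_spaceP _ (wedge_so w x)) (c := c + b).
rewrite adE addrK (wedge_eigen skM vA xA) => /(_ erefl)/eqP.
by rewrite -subr_eq0 addrK.
Qed.

Lemma horner_mx_semisimple c q :
  horner_mx A (q * ('X - c%:P) ^+ 2) = 0 -> horner_mx A (q * ('X - c%:P)) = 0.
Proof.
have hX : horner_mx A ('X - c%:P) = A - c%:M.
  by rewrite rmorphB /= horner_mx_X horner_mx_C.
rewrite expr2 mulrA !rmorphM /= hX -!mulmxE => q2.
apply/row_matrixP => i; rewrite row0 row_mul.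
by apply: eigen_semisimple; rewrite -!row_mul q2 row0.
Qed.

(** Repeated roots are removed one at a time by [horner_mx_semisimple]; the cofactor q collects the
    linear factors already passed. *)
Lemma horner_mx_undup q s :
  horner_mx A (q * \prod_(r <- s) ('X - r%:P)) = 0 ->
  horner_mx A (q * \prod_(r <- undup s) ('X - r%:P)) = 0.
Proof.
elim: s q => [|r s IHs] q //=; rewrite big_cons mulrA => /IHs.
case: ifPn => rs; last by rewrite big_cons mulrA.
rewrite -mem_undup in rs; rewrite (big_rem r rs) /=.
set p := \prod_(_ <- _) _ => h.
rewrite (_ : q * _ = q * p * ('X - r%:P)); last by rewrite mulrAC mulrA.
by apply: horner_mx_semisimple; rewrite -h; congr (horner_mx A _); ring.
Qed.

Lemma skew_diagonalizable : diagonalizable A.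
Proof.
have [s sE] := mxminpoly_split; apply/diagonalizableP.
exists (undup s); first exact: undup_uniq.
apply: mxminpoly_min; rewrite -[\prod_(_ <- _) _]mul1r.
by apply: horner_mx_undup; rewrite mul1r -sE mx_root_minpoly.
Qed.

(** Wedging an eigenvector for c with a kernel vector of A makes c an eigenvalue of ad M. *)
Lemma eigenvalue_neq0_int_le2 c :
  eigenvalue A c -> c != 0 -> exists n : nat, c = 2 - n%:R.
Proof.
move=> /eigenvalueP[v vA v0] c0; have /eigenvalueP[w wA w0] := eigenvalue_zero.
apply: (ad_eig (X := wedge v w)); first exact/so_spaceP/wedge_so.
  exact: wedge_eigen_neq0 c0 v0 w0 vA wA.
by rewrite (wedge_eigen skM vA wA) addr0.
Qed.

(** The upper bound applies to both c and -c; writing them as 2 - n and 2 - m gives n + m = 4. *)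
Lemma eigenvalue_int c :
  eigenvalue A c -> exists2 z : int, c = z%:~R & `|z| <= 2.
Proof.
move=> Ac; have [->|c0] := eqVneq c 0; first by exists 0.
have [n cn] := eigenvalue_neq0_int_le2 Ac c0.
have := eigenvalue_neq0_int_le2 (eigenvalue_opp Ac).
rewrite oppr_eq0 => /(_ c0)[m cm].
have /eqP : n%:Z + m%:Z = 4 :> int.
  apply/eqP; rewrite -(eqr_int K) intrD /= -!pmulrn; apply/eqP.
  have := congr1 (fun x => c + x) cm; rewrite subrr {1}cn.
  by move=> h; apply/eqP; rewrite eq_sym -subr_eq0 h; apply/eqP; ring.
exists (2 - n%:Z); first by rewrite cn intrB -pmulrn.
lia.
Qed.

(** If 2 is an eigenvalue then 1 is not, as ad M would have eigenvalue 3, and by symmetry neither is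
    -1. All eigenvalues of A are then even, hence so are those of ad M, which contradicts
    [ad_eig1]. *)
Lemma eigenvalue_not2 : ~~ eigenvalue A 2.
Proof.
apply/negP => A2.
have A1 : ~~ eigenvalue A 1.
  apply/negP => A1.
  have /eigenvalueP[v vA v0] := A2; have /eigenvalueP[w wA w0] := A1.
  have neq : 2 != 1 :> K by rewrite (eqr_nat K 2 1).
  have [n /eqP] := ad_eig (so_spaceP _ (wedge_so v w))
    (wedge_eigen_neq0 neq v0 w0 vA wA) (wedge_eigen skM vA wA).
  rewrite -subr_eq0 (_ : _ - _ = n.+1%:R) ?pnatr_eq0 // -natr1; ring.
have AN1 : ~~ eigenvalue A (- 1).
  by apply: contra A1 => /eigenvalue_opp; rewrite opprK.
have [P Pu /diagonalizable_forPex[d /(simmxPp (stablemx_unit _ Pu)) PA] ] :=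
  skew_diagonalizable.
have [X [skX X0 XE] ] := ad_eig1.
have [i [j Xij] ] := wedge_coord_neq0 Pu X0.
have := wedge_coord_commutator skM Pu PA X i j.
rewrite XE -[LHS]mul1r => /(mulIf Xij).
have d_int k : exists2 z : int, d 0 k = z%:~R & z \in [:: -2; 0; 2].
  have Ak := eigenvalue_diag Pu PA k.
  have [z dz z2] := eigenvalue_int Ak; exists z => //.
  have z1 : z != 1 by apply: contraNneq A1 => z1; rewrite -[1]/(1%:~R) -z1 -dz.
  have zN1 : z != -1.
    by apply: contraNneq AN1 => zE; rewrite -[1]/(1%:~R) -intrN -zE -dz.
  by rewrite !inE; lia.
have [z -> zP] := d_int i; have [w -> wP] := d_int j.
rewrite -[1]/(1%:~R) -intrD => /eqP; rewrite eqr_int.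
by move: zP wP; rewrite !inE; lia.
Qed.

(** The vanishing sum is the trace of a skew matrix; it will make the multiplicities of 1 and -1
    agree. *)
Lemma skew_spectrum : exists P : 'M_N.+1, exists z : 'I_N.+1 -> int,
  [/\ P \in unitmx, P *m A = diag_mx (\row_i (z i)%:~R) *m P,
      forall i, z i \in [:: -1; 0; 1] & \sum_i z i = 0].
Proof.
have [P Pu /diagonalizable_forPex[d /(simmxPp (stablemx_unit _ Pu)) PA] ] :=
  skew_diagonalizable.
have d_int k : exists z : int, d 0 k = z%:~R /\ z \in [:: -1; 0; 1].
  have Ak := eigenvalue_diag Pu PA k.
  have [z dz z2] := eigenvalue_int Ak; exists z; split=> //.
  have z1 : z != 2.
    by apply: contraNneq eigenvalue_not2 => z1; rewrite -[2]/(2%:~R) -z1 -dz.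
  have zN1 : z != -2.
    apply: contraNneq eigenvalue_not2 => zE.
    by rewrite -[2]/(2%:~R) -[2]opprK -zE intrN -dz; exact: eigenvalue_opp.
  by rewrite !inE; lia.
have [z zP] := fin_all_exists d_int.
have dE : d = \row_i (z i)%:~R by apply/rowP => i; rewrite mxE; case: (zP i).
exists P, z; split=> // [|i|]; [by rewrite -dE|by case: (zP i)|].
apply/eqP; rewrite -(eqr_int K) rmorph_sum /=; apply/eqP.
have <- : \tr (diag_mx d) = \sum_i (z i)%:~R.
  by rewrite mxtrace_diag dE; apply: eq_bigr => i _; rewrite mxE.
have -> : diag_mx d = P *m A *m invmx P by rewrite PA mulmxK.
rewrite mxtrace_mulC mulmxA mulVmx // mul1mx.
have : \tr A = - \tr A.
  by rewrite /A mxtrace_tr -[M in LHS]opprK -skM raddfN /= mxtrace_tr.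
by move=> /eqP; rewrite -addr_eq0 -mulr2n mulrn_eq0 => /eqP.
Qed.

End SkewMatrix.

(** * Dimensions of the graded pieces by counting pairs of eigenvalues *)

(** The bivectors of rows i < j of P form an eigenbasis of ad E with eigenvalues d_i + d_j; those
    with eigenvalue c are a basis of U. *)
Lemma dim_ad_eigenspace (K : numFieldType) N (E : so K N) (P : 'M[K]_N)
    (d : 'rV[K]_N) (c : K) (U : {vspace so K N}) :
    P \in unitmx -> P *m (vsval E)^T = diag_mx d *m P ->
    (forall x, x \in U <-> [[E, x]] = c *: x) ->
  \dim U = #|[set p : 'I_N * 'I_N | (p.1 < p.2)%N && (d 0 p.1 + d 0 p.2 == c)]|.
Proof.
move=> Pu PM UP; set T := [set p | _].
have skM : (vsval E)^T = - vsval E by apply/so_spaceP/subvsP.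
pose B (p : 'I_N * 'I_N) : so K N := Subvs (wedge_so (row p.1 P) (row p.2 P)).
pose y i j (x : so K N) := wedge_coord P (vsval x) i j.
have y_lin i j : linear (y i j : _ -> K^o).
  by move=> k u v; rewrite /y linearP wedge_coord_linear !mxE.
pose Y i j : {linear so K N -> K^o} := HB.pack (y i j : _ -> K^o)
  (GRing.isLinear.Build K (so K N) K^o *:%R (y i j : _ -> K^o) (y_lin i j)).
have YB p i j : Y i j (B p) =
    ((i == p.1) && (j == p.2))%:R - ((i == p.2) && (j == p.1))%:R.
  exact: wedge_coord_wedge.
have YBT p (i j : 'I_N) :
    p \in T -> (i < j)%N -> Y i j (B p) = (p == (i, j))%:R.
  rewrite inE => /andP[p12 _] ij; rewrite YB.
  have -> : (i == p.2) && (j == p.1) = false.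
    apply/negbTE/negP => /andP[/eqP i2 /eqP j1].
    by move: ij; rewrite i2 j1 ltnNge (ltnW p12).
  by rewrite subr0 eq_sym [j == _]eq_sym.
have Yad i j x : Y i j [[E, x]] = (d 0 i + d 0 j) * Y i j x.
  exact: wedge_coord_commutator.
have Y_inj x x' :
    (forall i j : 'I_N, (i < j)%N -> Y i j x = Y i j x') -> x = x'.
  move=> xx'; apply/val_inj/(can_inj (wedge_coordK Pu))/matrixP => i j.
  have skx u : (vsval u)^T = - vsval (u : so K N) by apply/so_spaceP/subvsP.
  have [ij|ji|/val_inj ->] := ltngtP i j; first exact: xx'.
    by rewrite !(wedge_coord_skew P j i (skx _)); congr (- _); apply: xx'.
  have diag0 u : wedge_coord P (vsval (u : so K N)) j j = 0.
    have /eqP := wedge_coord_skew P j j (skx u).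
    by rewrite -addr_eq0 -mulr2n mulrn_eq0 => /eqP.
  by rewrite -!/(vsval _) !diag0.
pose X := [tuple B (enum_val i) | i < #|T|].
have XE (l : 'I_#|T|) : X`_l = B (enum_val l) by rewrite -tnth_nth tnth_mktuple.
have lt12 (l : 'I_#|T|) : ((enum_val l).1 < (enum_val l).2)%N.
  by have := enum_valP l; rewrite inE => /andP[].
have Xfree : free X.
  apply/freeP => k k0 l; have := congr1 (Y (enum_val l).1 (enum_val l).2) k0.
  rewrite linear0 linear_sum (bigD1 l) // big1 => [|l' ll'].
    rewrite linearZ XE YBT ?enum_valP ?lt12 // -surjective_pairing eqxx /=.
    rewrite addr0.
    exact: (etrans (esym (mulr1 _))).
  rewrite linearZ XE YBT ?enum_valP ?lt12 //.
  rewrite -surjective_pairing (inj_eq enum_val_inj) (negPf ll').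
  exact: mulr0.
suff Xb : basis_of U X by rewrite -(size_basis Xb).
apply/andP; split=> //; rewrite eqEsubv; apply/andP; split.
  apply/span_subvP => _ /tnthP[l ->]; rewrite tnth_mktuple.
  have := enum_valP l; rewrite inE => /andP[_ /eqP pc].
  apply/UP/val_inj => /=; rewrite -pc.
  by apply: wedge_eigen => //; apply: row_eigen.
apply/subvP => x /UP xc.
(* An eigenvector for c has nonzero coordinates only at pairs whose eigenvalues sum to c. *)
have xd i j : Y i j x != 0 -> d 0 i + d 0 j = c.
  by move=> x0; have := Yad i j x; rewrite xc linearZ => /(mulIf x0).
have -> : x = \sum_(l < #|T|) Y (enum_val l).1 (enum_val l).2 x *: X`_l.
  apply: Y_inj => i j ij; rewrite linear_sum.
  have [pT|pT] := boolP ((i, j) \in T).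
    rewrite (bigD1 (enum_rank_in pT (i, j))) // big1 => [|l lp].
      rewrite linearZ XE enum_rankK_in // YBT // eqxx /= addr0.
      exact/esym/mulr1.
    rewrite linearZ XE YBT ?enum_valP //.
    rewrite (_ : (_ == _) = false); first exact: mulr0.
    apply: contraNF lp => /eqP h.
    by rewrite -[X in enum_rank_in _ X]h enum_valK_in.
  rewrite big1 => [|l _].
    by apply: contraNeq pT => /xd xc'; rewrite inE ij xc' /=.
  rewrite linearZ XE YBT ?enum_valP //.
  rewrite (_ : (_ == _) = false); first exact: mulr0.
  by apply: contraNF pT => /eqP <-; exact: enum_valP.
by apply: rpred_sum => l _; apply/rpredZ/memv_span/mem_nth; rewrite size_tuple.
Qed.

(** Swapping the components matches the pairs below the diagonal with those above it. The doubled
    count replaces binomial coefficients by products. *)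
Lemma card_ltn_symmetric N (r : rel 'I_N) : symmetric r ->
  (#|[set p : 'I_N * 'I_N | (p.1 < p.2)%N && r p.1 p.2]| * 2)%N
  = #|[set p : 'I_N * 'I_N | (p.1 != p.2) && r p.1 p.2]|.
Proof.
move=> rsym; set A := [set p | _]; set B := [set p | _].
pose sw (p : 'I_N * 'I_N) := (p.2, p.1).
have sw_inj : injective sw by move=> [i j] [k l] [-> ->].
rewrite -(cardsID A B) (_ : B :&: A = A); last first.
  apply/setIidPr/subsetP => p; rewrite !inE => /andP[p12 ->].
  by rewrite neq_ltn p12.
rewrite (_ : B :\: A = sw @: A); first by rewrite card_imset // muln2 addnn.
apply/setP => -[i j]; rewrite !inE /=; apply/idP/imsetP => [|[ [k l] ] ].
  move=> /and3P[ij ij' rij]; exists (j, i) => //; rewrite inE /= rsym rij andbT.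
  move: ij ij'; rewrite rij andbT -leqNgt leq_eqVlt eq_sym.
  by move=> /predU1P[/val_inj ->|]; rewrite ?eqxx.
rewrite inE /= => /andP[kl rkl] [-> ->].
by rewrite rsym rkl !andbT -leqNgt (ltnW kl) neq_ltn kl orbT.
Qed.

Lemma card_offdiag N (S : {set 'I_N}) :
  #|[set p : 'I_N * 'I_N | (p.1 != p.2) && ((p.1 \in S) && (p.2 \in S))]|
  = (#|S| * #|S|.-1)%N.
Proof.
pose dg (i : 'I_N) := (i, i).
have dg_inj : injective dg by move=> i j [].
have := cardsID (dg @: S) (setX S S).
rewrite cardsX (_ : _ :&: _ = dg @: S); last first.
  by apply/setIidPr/subsetP => _ /imsetP[i iS ->]; rewrite inE iS.
rewrite card_imset // (_ : _ :\: _ =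
    [set p | (p.1 != p.2) && ((p.1 \in S) && (p.2 \in S))]).
  by case: #|S| => [|k]; [|rewrite mulnS => /addnI].
apply/setP => -[i j]; rewrite !inE /=.
apply/andP/andP => -[h /andP[iS jS] ]; split; rewrite ?iS ?jS //; move: h.
  by apply: contraNneq => ->; apply: imset_f.
by apply: contraNN => /imsetP[k _ [-> ->] ].
Qed.

Lemma card_cross N (S Z : {set 'I_N}) : [disjoint S & Z] ->
  #|[set p : 'I_N * 'I_N | (p.1 != p.2) &&
     ((p.1 \in S) && (p.2 \in Z) || (p.1 \in Z) && (p.2 \in S))]|
  = (#|S| * #|Z| * 2)%N.
Proof.
move=> dSZ; rewrite (_ : [set p | _] = setX S Z :|: setX Z S).
  rewrite cardsU !cardsX (_ : _ :&: _ = set0) ?cards0.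
    by rewrite subn0 (mulnC #|Z|) addnn muln2.
  apply/setP => -[i j]; rewrite !inE /=.
  apply/negbTE/negP => /and3P[/andP[iS _] iZ _].
  by have := disjointFr dSZ iS; rewrite iZ.
apply/setP => -[i j]; rewrite !inE /= andb_idl //.
case/orP=> /andP[iS jZ]; apply: contraTneq jZ => <-.
  by rewrite (disjointFr dSZ iS).
by rewrite (disjointFl dSZ iS).
Qed.

(** A zero sum forces as many 1s as -1s, so the nonzero entries are even in number. *)
Lemma balanced_signs_card N (z : 'I_N -> int) :
    (forall i, z i \in [:: -1; 0; 1]) -> \sum_i z i = 0 -> odd N ->
  odd #|[set i | z i == 0%R]|.
Proof.
move=> zP z0 oddN; set S := [set i | z i == -1]; set Z := [set i | _].
pose T := [set i | z i == 1].
have ST : #|T| = #|S|.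
  apply/eqP; rewrite -(eqr_nat int) -subr_eq0 -z0 -!sum1_card !natr_sum.
  rewrite big_mkcond [X in _ - X]big_mkcond -sumrB; apply/eqP/eq_bigr => i _.
  by have := zP i; rewrite !inE => /or3P[] /eqP ->.
have NE : N = (#|S| + #|T| + #|Z|)%N.
  rewrite -[LHS]card_ord -!sum1_card !(big_mkcond (fun i => i \in _)) /=.
  rewrite -!big_split /=; apply: eq_bigr => i _.
  by have := zP i; rewrite !inE => /or3P[] /eqP ->.
by have := congr1 odd NE; rewrite oddN ST oddD addnn odd_double.
Qed.

Lemma so_abs2_grading_dim (K : numClosedFieldType) N (D : rootDatum (so K N))
    (Sigma : {set 'I_(rank D)}) : odd N -> is_abs2_grading Sigma ->
  exists m a : nat, [/\ odd a, (\dim (grading Sigma (-2)) * 2 = m * m.-1)%N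
    & \dim (grading Sigma (-1)) = (m * a)%N].
Proof.
case: N => // N in D Sigma *; move=> oddN /abs2_grading_element.
move=> [E [ss up [x1 x10 x1E] [x2 x20 x2E] gradE] ].
have skE : (vsval E)^T = - vsval E by apply/so_spaceP/subvsP.
have lift (X : 'M_N.+1) : X^T = - X -> exists x : so K N.+1, vsval x = X.
  by move=> /so_spaceP skX; exists (Subvs skX).
have [||||P [z [Pu PE zP z0] ] ] := skew_spectrum skE oddN.
- move=> c _ /lift[x <-] h.
  have /(congr1 vsval) // : [[E, x]] = c *: x by apply/ss/val_inj.
- move=> c _ /lift[x <-] x0 h; apply: (up c x); last exact/val_inj.
  by apply: contraNneq x0 => ->.
- exists (vsval x1); split; first exact/so_spaceP/subvsP.
    by apply: contraNneq x10 => h; apply/eqP/val_inj.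
  exact: (congr1 vsval x1E).
- exists (vsval x2); split; first exact/so_spaceP/subvsP.
    by apply: contraNneq x20 => h; apply/eqP/val_inj.
  exact: (congr1 vsval x2E).
set S := [set i | z i == -1]; pose Z := [set i | z i == 0%R].
have dimE (k : int) : k != 0 -> \dim (grading Sigma k) =
    #|[set p : 'I_N.+1 * 'I_N.+1 | (p.1 < p.2)%N && (z p.1 + z p.2 == k)]|.
  move=> k0; rewrite (dim_ad_eigenspace Pu PE (fun x => gradE k x k0)).
  by apply: eq_card => p; rewrite !inE !mxE -intrD eqr_int.
(* With entries in -1, 0, 1, a sum of -2 needs both indices in S, and a sum of -1 needs one in S and
   one in Z. *)
exists #|S|, #|Z|; split; first exact: balanced_signs_card.
  rewrite dimE // (@card_ltn_symmetric _ (fun i j => z i + z j == - 2)).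
    rewrite -card_offdiag; apply: eq_card => -[i j]; rewrite !inE /=.
    have := zP i; have := zP j; rewrite !inE.
    by move=> /or3P[] /eqP -> /or3P[] /eqP ->.
  by move=> i j; rewrite addrC.
apply/eqP; rewrite -(eqn_pmul2r (isT : 0 < 2)%N) dimE //.
rewrite (@card_ltn_symmetric _ (fun i j => z i + z j == - 1)); last first.
  by move=> i j; rewrite addrC.
rewrite -card_cross; last first.
  by rewrite disjoints_subset; apply/subsetP => i; rewrite !inE => /eqP ->.
apply/eqP; apply: eq_card => -[i j]; rewrite !inE /=.
by have := zP i; have := zP j; rewrite !inE => /or3P[] /eqP -> /or3P[] /eqP ->.
Qed.

(** * The arithmetic contradiction *)

(** As a is odd, the power of 2 would divide m. For m at least 5, p/2 is at least m and 2^m > m. For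
    m = 3 and m = 4 the power is 2 and 8 respectively, and m at most 2 gives p at most 1. *)
Lemma clifford_dim_ndvd m a p : odd a -> (p * 2 = m * m.-1)%N -> (1 < p)%N ->
  ~~ (2 ^ p./2 %| m * a)%N.
Proof.
move=> odda pm p1; rewrite Gauss_dvdl ?coprimeXl ?coprime2n //.
have [m5|] := leqP 5 m.
  apply/negP => /(dvdn_leq (leq_trans (isT : 0 < 5)%N m5)).
  apply/negP; rewrite -ltnNge.
  apply: (leq_trans (ltn_expl m (isT : 1 < 2)%N)); rewrite leq_exp2l //.
  by case: m m5 pm => // m m5 /= pm; nia.
by case: m pm => [|[|[|[|[|m] ] ] ] ] //= pm _; [lia|lia|lia| |];
  [have -> : p = 3 by lia|have -> : p = 6 by lia].
Qed.

Theorem theorem4 (R : realType) (n : nat) (n_ge2 : (2 <= n)%N)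
    (D : rootDatum (so R[i] (2 * n + 1))) (Sigma : {set 'I_(rank D)}) :
  is_abs2_grading Sigma ->
  (1 < \dim (grading Sigma (-2)))%N ->
  ~ exists N : pseudoHType R,
      \dim (part2 N) = \dim (grading Sigma (-2)) /\
      \dim (part1 N) = \dim (grading Sigma (-1)).
Proof.
move=> abs2 dim2 [N [d2 d1] ].
have oddN : odd (2 * n + 1) by rewrite oddD oddM.
have [m [a [odda dm da] ] ] := so_abs2_grading_dim oddN abs2.
have := pseudoH_dim_dvd N; rewrite d2 d1 da.
by apply/negP; apply: clifford_dim_ndvd odda dm dim2.
Qed.
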